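(* Let $d\ge1$ and $M\ge 2$ be integers, and let $A>1$ and $q>0$ be real numbers. There is a constant $c>0$ depending only on $A$ and $q$ such that for all integers $n\ge1$ with $\log M\le 16(\min(1,A-1))^2 n$, $$\sup_{f_1,\dots,f_M\in\mathcal{F}_H(A)}\ \inf_{\hat f_n}\ \sup_{f\in\mathcal{F}(A)}\left[\mathbb{E}_f\left[H(\hat f_n,f)^q\right]-\min_{j=1,\dots,M}H(f_j,f)^q\right]\ge c\left(\frac{\log M}{n}\right)^{q/2},$$ where the infimum is over all estimators based on a sample of size $n$.
   Context: Setting: $X_1,\dots,X_n$ are i.i.d. observations in $\mathbb{R}^d$ with unknown probability density $f$ with respect to Lebesgue measure; $\mathbb{E}_f$ is the expectation when the true density is $f$. $\mathcal{F}(A)$ is the set of probability densities on $\mathbb{R}^d$ bounded by $A$; $\mathcal{F}_H(A)$ is the set of non-negative measurable functions on $\mathbb{R}^d$ bounded by $A$. An estimator $\hat f_n$ is a (jointly measurable) function $\hat f_n(x)=\hat f_n(x;X_1,\dots,X_n)$ of $x$ and the sample which is, here, non-negative, so that the loss is defined. Hellinger distance: for non-negative measurable $f,g$, $H(f,g)=\|\sqrt f-\sqrt g\|_2=\left(\int_{\mathbb{R}^d}(\sqrt{f}-\sqrt{g})^2dx\right)^{1/2}\in[0,\infty]$. Convention: the supremum over $f$ is taken over those $f$ for which the subtracted minimum is finite. The constant $c$ does not depend on $M$, $n$ or $d$. *)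

(* Defs.v *)
From HB Require Import structures.
From mathcomp Require Import all_boot all_order all_algebra.
From mathcomp Require Import all_classical all_reals all_analysis.

Set Implicit Arguments.
Unset Strict Implicit.
Unset Printing Implicit Defensive.

Import Order.TTheory GRing.Theory Num.Theory.
Import numFieldNormedType.Exports.

Local Open Scope classical_set_scope.
Local Open Scope ring_scope.

Section power_measure.
Context {disp : measure_display} {T : measurableType disp} {R : realType}.

Definition tcons n (p : T * n.-tuple T) : n.+1.-tuple T :=
  [tuple of p.1 :: p.2].

Lemma measurable_tcons n : measurable_fun [set: T * n.-tuple T] (@tcons n).
Proof. exact: measurable_cons measurable_fst measurable_snd. Qed.

(* The n-fold product of mu with itself, on the product sigma-algebra of
   n.-tuple T. It is defined for a bare set function, so that it can be formed
   before mu is known to be a measure. *)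
Fixpoint power_measure (mu : set T -> \bar R) (n : nat) :
    set (n.-tuple T) -> \bar R :=
  match n with
  | 0 => dirac ([tuple] : 0.-tuple T)
  | m.+1 => pushforward (mu \x @power_measure mu m)%E (@tcons m)
  end.
Arguments power_measure mu n A : clear implicits.

Section sigma_finite.
Variable mu : {sigma_finite_measure set T -> \bar R}.

Lemma sigma_finite_pushforward_tcons n
    (nu : {sigma_finite_measure set (n.-tuple T) -> \bar R}) :
  sigma_finite setT (pushforward (mu \x nu)%E (@tcons n)).
Proof.
have /sigma_finiteP[F [TF ndF Foo]] := sigma_finiteT mu.
have /sigma_finiteP[G [TG ndG Goo]] := sigma_finiteT nu.
pose u (t : n.+1.-tuple T) : T * n.-tuple T := (thead t, [tuple of behead t]).
have tconsK : cancel (@tcons n) u.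
  by move=> [x t]; rewrite /u /tcons theadE; congr pair; apply/val_inj.
have mu_ : measurable_fun setT u.
  apply/measurable_fun_pairP; split => /=; last exact: measurable_behead.
  exact: measurable_tnth.
exists (fun k => u @^-1` (F k `*` G k)).
  rewrite -preimage_bigcup; apply/seteqP; split => // t _.
  have [k _ Fk] : (\bigcup_k F k) (u t).1 by rewrite -TF.
  have [l _ Gl] : (\bigcup_k G k) (u t).2 by rewrite -TG.
  exists (maxn k l) => //; split.
    by move: Fk; exact/subsetPset/ndF/leq_maxl.
  by move: Gl; exact/subsetPset/ndG/leq_maxr.
move=> k; have [mF Fk] := Foo k; have [mG Gk] := Goo k; split.
  by rewrite -[X in measurable X]setTI; apply: mu_ => //; exact: measurableX.
rewrite /pushforward -comp_preimage (_ : u \o _ = id); last exact/funext/tconsK.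
by rewrite preimage_id product_measure1E// lte_mul_pinfty// ge0_fin_numE.
Qed.

Lemma power_measure_sigma_finite n :
  exists nu : {sigma_finite_measure set (n.-tuple T) -> \bar R},
    power_measure mu n = nu.
Proof.
elim: n => [|n [nu IH]]; first by exists (dirac ([tuple] : 0.-tuple T)).
pose m : {measure set (n.+1.-tuple T) -> \bar R} :=
  measure_function_pushforward__canonical__measure_function_Measure
    (mu \x nu)%E (@measurable_tcons n).
pose H := @Measure_isSigmaFinite.Build _ _ _ (Measure.sort m)
  (sigma_finite_pushforward_tcons nu).
pose m' := HB.pack_for (SigmaFiniteMeasure.type (n.+1.-tuple T) R)
  (Measure.sort m) H.
by exists m'; rewrite /= IH.
Qed.

Variable n : nat.

Let power_measure0 : power_measure mu n set0 = 0%E.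
Proof. by have [nu ->] := power_measure_sigma_finite n. Qed.

Let power_measure_ge0 A : (0 <= power_measure mu n A)%E.
Proof. by have [nu ->] := power_measure_sigma_finite n. Qed.

Let power_measure_sigma_additive : semi_sigma_additive (power_measure mu n).
Proof.
have [nu ->] := power_measure_sigma_finite n.
exact: measure_semi_sigma_additive.
Qed.

HB.instance Definition _ := isMeasure.Build _ _ _ (power_measure mu n)
  power_measure0 power_measure_ge0 power_measure_sigma_additive.

Let power_measure_sigma_finiteT : sigma_finite setT (power_measure mu n).
Proof. have [nu ->] := power_measure_sigma_finite n; exact: sigma_finiteT. Qed.

HB.instance Definition _ := Measure_isSigmaFinite.Build _ _ _
  (power_measure mu n) power_measure_sigma_finiteT.

End sigma_finite.

Lemma power_measure_box (mu : {sigma_finite_measure set T -> \bar R}) n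
    (A : 'I_n -> set T) : (forall i, measurable (A i)) ->
  power_measure mu n [set t | forall i, A i (tnth t i)] =
  (\prod_(i < n) mu (A i))%E.
Proof.
elim: n A => [|n IH] A mA.
  by rewrite big_ord0 /= diracE mem_set// => -[].
rewrite big_ord_recl -IH//= /pushforward.
have mB : measurable [set t : n.-tuple T | forall i, A (lift ord0 i) (tnth t i)].
  rewrite (_ : mkset _ =
      \bigcap_(i in [set: 'I_n]) (@tnth _ T ^~ i) @^-1` A (lift ord0 i)).
    apply: fin_bigcap_measurable => // i _.
    by rewrite -[X in measurable X]setTI; exact: measurable_tnth.
  by apply/seteqP; split => [t h i _|t h i]; exact: h.
rewrite -product_measure1E//; congr (_ _).
apply/seteqP; split => [[x t] /= h|[x t] /= [h0 h] i].
  split; first exact: h ord0.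
  by move=> i; have := h (lift ord0 i); rewrite /tcons tnthS.
by case: (unliftP ord0 i) => [j ->|->] //; rewrite /tcons tnthS.
Qed.

End power_measure.
Arguments power_measure {disp T R} mu n A.

Section aggregation.
Context {R : realType}.

(* R^d with its Borel sigma-algebra *)
Definition Rd (d : nat) := d.-tuple (measurableTypeR R).

HB.instance Definition _ d := Measurable.on (Rd d).

Definition lebesgue_Rd d : set (Rd d) -> \bar R :=
  power_measure (@lebesgue_measure R) d.

HB.instance Definition _ d := SigmaFiniteMeasure.on (@lebesgue_Rd d).

Definition bounded_nonneg d (A : R) : set (Rd d -> R) :=
  [set f : Rd d -> R | measurable_fun [set: Rd d] f /\ forall x, 0 <= f x <= A].

Definition bounded_density d (A : R) : set (Rd d -> R) :=
  [set f : Rd d -> R | bounded_nonneg A f /\ (\int[@lebesgue_Rd d]_x (f x)%:E = 1)%E].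

Definition hellinger d (f g : Rd d -> R) : \bar R :=
  Lnorm (@lebesgue_Rd d) 2%:E (fun x => (Num.sqrt (f x) - Num.sqrt (g x))%:E).

Definition density_law d (f : Rd d -> R) : set (Rd d) -> \bar R :=
  fun B => (\int[@lebesgue_Rd d]_(x in B) (f x)%:E)%E.

(* The sample X = (X_1, ..., X_n) is realized as the coordinate maps on
   n.-tuple (Rd d) under the n-fold product of the law with density f. *)
Definition expectation_iid d n (f : Rd d -> R) (Z : n.-tuple (Rd d) -> \bar R) :
    \bar R :=
  (\int[power_measure (density_law f) n]_X Z X)%E.

Definition estimator d n : set (n.-tuple (Rd d) -> Rd d -> R) :=
  [set fhat : n.-tuple (Rd d) -> Rd d -> R |
    measurable_fun [set: n.-tuple (Rd d) * Rd d] (fun p => fhat p.1 p.2) /\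
    forall X x, 0 <= fhat X x].

Definition hellinger_risk d n (q : R) (fhat : n.-tuple (Rd d) -> Rd d -> R)
    (f : Rd d -> R) : \bar R :=
  expectation_iid f (fun X => hellinger (fhat X) f `^ q)%E.

Definition oracle_risk d M (q : R) (fs : 'I_M -> Rd d -> R) (f : Rd d -> R) :
    \bar R :=
  \big[Order.min/+oo%E]_(j < M) (hellinger (fs j) f `^ q)%E.

(* The supremum runs over the f with finite oracle risk, so the subtraction is
   never +oo - +oo; it is -oo when no density satisfies this condition. *)
Definition worst_regret d n M (A q : R) (fs : 'I_M -> Rd d -> R)
    (fhat : n.-tuple (Rd d) -> Rd d -> R) : \bar R :=
  ereal_sup [set (hellinger_risk q fhat f - oracle_risk q fs f)%E |
    f in [set f : Rd d -> R | bounded_density A f /\ (oracle_risk q fs f < +oo)%E]].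

End aggregation.

(* Main.v *)
(** The oracle functions can be taken to be the hypotheses themselves, so that
    the oracle risk vanishes at each of them and it remains to bound a minimax
    risk over M densities from below.  Let B_1, ..., B_M be the positivity sets
    of independent Rademacher functions on the unit cube Q, let
    gamma = sqrt (ln M / n) / 4 and f_j = 1 + gamma on B_j, 1 - gamma on
    Q \ B_j.  Distinct f_j are at Hellinger distance at least gamma / 2, so
    the events A_j = "the estimator is within gamma / 4 of f_j" are disjoint,
    and some A_j has probability at most 1 / M under the uniform law of the
    sample on Q.  The chi-square divergence of f_j from that law is gamma^2;
    tensorizing the Cauchy-Schwarz inequality (by induction on n, applied to
    the square root of the measure of the sections of A_j) gives
    P_j(A_j) <= (1 + gamma^2)^(n/2) M^(-1/2) <= M^(-15/32) < 1, hence the risk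
    at f_j is at least a constant times (gamma / 4)^q. *)

From HB Require Import structures.
Require Import Defs.
From mathcomp Require Import all_boot all_order all_algebra.
From mathcomp Require Import all_classical all_reals all_analysis.
From mathcomp Require Import measurable_realfun.
From mathcomp Require Import ring lra.

Import Order.TTheory GRing.Theory Num.Theory.
Import numFieldNormedType.Exports.

Local Open Scope classical_set_scope.
Local Open Scope ring_scope.

(** * Product laws *)

Lemma measurable_funT_sqrt (R : realType) d (T : measurableType d) (f : T -> R) :
  measurable_fun setT f -> measurable_fun setT (fun x => Num.sqrt (f x)).
Proof.
move=> mf; apply: measurableT_comp mf.
by apply: continuous_measurable_fun; exact: sqrt_continuous.
Qed.

Section density_probability.
Context {disp : measure_display} {T : measurableType disp} {R : realType}.
Local Open Scope ereal_scope.
Variables (mu : {sigma_finite_measure set T -> \bar R}) (f : T -> R).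
Hypotheses (mf : measurable_fun [set: T] f) (f0 : forall x, (0 <= f x)%R).
Hypothesis f1 : \int[mu]_x (f x)%:E = 1.

(** The law with density [f] over a general base measure; for Lebesgue measure on R^d it is
    convertible to [density_law]. *)
Definition density_probability (B : set T) : \bar R := \int[mu]_(x in B) (f x)%:E.

Let dp0 : density_probability set0 = 0.
Proof. exact: integral_set0. Qed.

Let dp_ge0 B : 0 <= density_probability B.
Proof. by apply: integral_ge0 => x _; rewrite lee_fin. Qed.

Let dp_sigma_additive : semi_sigma_additive density_probability.
Proof.
move=> F mF tF mUF; rewrite /density_probability; apply: cvg_toP.
  apply: ereal_nondecreasing_is_cvgn => m n mn.
  apply: lee_sum_nneg_natr => // k _ _.
  by apply: integral_ge0 => x _; rewrite lee_fin.
rewrite ge0_integral_bigcup//=; last by move=> x _; rewrite lee_fin.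
exact/measurable_funTS/measurable_EFinP.
Qed.

(** The measure structure depends on the hypotheses on [f], so it is packed under an existential;
    laws are then handled through equations [density_law f = P]. *)
Lemma density_probability_ex : exists P : probability T R,
  density_probability = P.
Proof.
pose m := HB.pack_for {measure set T -> \bar R} density_probability
  (isMeasure.Build _ _ _ density_probability dp0 dp_ge0 dp_sigma_additive).
pose H := @Measure_isProbability.Build _ _ _ (Measure.sort m) f1.
by exists (HB.pack_for (probability T R) (Measure.sort m) H).
Qed.

Lemma integral_density_probability (P : probability T R) (h : T -> \bar R) :
  density_probability = P -> measurable_fun setT h -> (forall x, 0 <= h x) ->
  \int[P]_x h x = \int[mu]_x (h x * (f x)%:E).
Proof.
move=> eP mh h0.
have PE B : P B = \int[mu]_(x in B) (f x)%:E by rewrite -eP.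
have Pmu : P `<< mu.
  apply/null_content_dominatesP => A mA A0; rewrite -[LHS]/(P A) PE.
  by rewrite null_set_integral//; exact/measurable_funTS/measurable_EFinP.
(* The Radon-Nikodym derivative of [P] agrees with [f] almost everywhere, because both have the same
   integral over every measurable set. *)
rewrite -(Radon_Nikodym_SigmaFinite.change_of_variables Pmu)//.
have mg := measurable_int _ (Radon_Nikodym_SigmaFinite.f_integrable Pmu).
apply: ae_eq_integral => //.
- exact: emeasurable_funM.
- by apply: emeasurable_funM => //; exact/measurable_EFinP.
apply: ae_eqe_mul2l; apply: integral_ae_eq => //.
- exact: Radon_Nikodym_SigmaFinite.f_integrable.
- exact/measurable_EFinP.
- by move=> E _ mE; rewrite -Radon_Nikodym_SigmaFinite.f_integral//; exact: PE.
Qed.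

End density_probability.

Section tensorization.
Context {disp : measure_display} {T : measurableType disp} {R : realType}.
Local Open Scope ereal_scope.

Lemma power_measure_setT (P : probability T R) n :
  power_measure P n [set: n.-tuple T] = 1.
Proof.
have := @power_measure_box _ _ _ P n (fun=> setT) (fun=> measurableT).
rewrite (_ : [set t | _] = setT); last by apply/seteqP; split.
move=> ->; apply: big1 => i _; exact: probability_setT.
Qed.

Lemma power_measure_le1 (P : probability T R) n (A : set (n.-tuple T)) :
  measurable A -> power_measure P n A <= 1.
Proof.
by move=> mA; rewrite -(power_measure_setT P n); apply: le_measure; rewrite ?inE.
Qed.

Lemma power_measure_fin_num (P : probability T R) n (A : set (n.-tuple T)) :
  measurable A -> power_measure P n A \is a fin_num.
Proof.
move=> mA; rewrite ge0_fin_numE//; apply: le_lt_trans (ltry 1).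
exact: power_measure_le1.
Qed.

(** The hypothesis is the case of one observation, with constant [k]. In the induction, P^(n+1)(A)
    is the P-integral of the P^n-measure of the sections of [A], which is at most k^n times the root
    of their Q^n-measure; the hypothesis applied to that root contributes the last factor [k]. *)
Lemma power_measure_cauchy_schwarz (P Q : probability T R) (k : R) n
    (A : set (n.-tuple T)) :
  (0 <= k)%R ->
  (forall (h : T -> R) (s : R), measurable_fun [set: T] h -> (forall x, (0 <= h x)%R) ->
    \int[Q]_x (h x ^+ 2)%:E = s%:E ->
    \int[P]_x (h x)%:E <= (k * Num.sqrt s)%:E) ->
  measurable A ->
  power_measure P n A <= (k ^+ n * Num.sqrt (fine (power_measure Q n A)))%:E.
Proof.
move=> k0 PQ; elim: n A => [|n IH] A mA.
  (* Both measures are the same Dirac mass, with value 0 or 1, which is its own square root. *)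
  rewrite /= !(diracE, indicE) expr0 mul1r; case: (_ \in A) => /=.
    by rewrite sqrtr1.
  by rewrite sqrtr0.
pose A' := @tcons _ T n @^-1` A.
have mA' : measurable A'.
  by rewrite -[X in measurable X]setTI; apply: measurable_tcons.
have eA (S : probability T R) :
    power_measure S n.+1 A = \int[S]_x power_measure S n (xsection A' x) by [].
have mX x : measurable (xsection A' x) by exact: measurable_xsection.
have mS (S : probability T R) :
    measurable_fun setT (fun x => power_measure S n (xsection A' x)).
  exact: (@measurable_fun_xsection _ _ _ _ _ (power_measure S n)).
pose h x := Num.sqrt (fine (power_measure Q n (xsection A' x))).
have mh : measurable_fun setT h.
  by apply: measurable_funT_sqrt; exact: (measurableT_comp (fine_measurable _)).
have Qfin := @power_measure_fin_num Q _ _ mA.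
rewrite !eA in Qfin *.
have h2 x : (h x ^+ 2)%:E = power_measure Q n (xsection A' x).
  by rewrite sqr_sqrtr ?fine_ge0// fineK//; exact: power_measure_fin_num.
have hs : \int[Q]_x (h x ^+ 2)%:E =
    (fine (\int[Q]_x power_measure Q n (xsection A' x)))%:E.
  by rewrite fineK//; apply: eq_integral => x _; exact: h2.
apply: (@le_trans _ _ (\int[P]_x ((k ^+ n)%:E * (h x)%:E))).
  apply: ge0_le_integral => //.
  - by apply: measurable_funeM; exact/measurable_EFinP.
  - by move=> x _; rewrite -EFinM; exact: IH.
rewrite ge0_integralZl//; last 3 first.
- exact/measurable_EFinP.
- by move=> x _; rewrite lee_fin sqrtr_ge0.
- by rewrite lee_fin exprn_ge0.
rewrite exprSr -mulrA EFinM; apply: lee_wpmul2l; first by rewrite lee_fin exprn_ge0.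
by apply: PQ => // x; exact: sqrtr_ge0.
Qed.

End tensorization.

(** * Rademacher sets *)

Section cells.
Context {R : realType} (W : finType).

(** The unit interval is cut into [#|W|] half-open intervals of equal length. With the 0-1 words of
    length [M] as [W], it carries [M] independent fair bits. *)
Definition cell (w : W) : set R :=
  `[(enum_rank w)%:R / #|W|%:R, (enum_rank w).+1%:R / #|W|%:R[.

Definition cells (S : {set W}) : set R := \bigcup_(w in [set` enum S]) cell w.

Lemma trivIset_cell (D : set W) : trivIset D cell.
Proof.
move=> v w _ _ [x []]; rewrite /cell /= !in_itv/= => /andP[vx xv] /andP[wx xw].
have N0 : (0 : R) < #|W|%:R by rewrite ltr0n; apply/card_gt0P; exists v.
have := le_lt_trans vx xw; have := le_lt_trans wx xv.
rewrite !ltr_pM2r ?invr_gt0// !ltr_nat !ltnS => wv vw.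
by apply/enum_rank_inj/val_inj/eqP; rewrite eqn_leq vw.
Qed.

Lemma measurable_cells S : measurable (cells S : set (measurableTypeR R)).
Proof. by apply: fin_bigcup_measurable => // w _; exact: measurable_itv. Qed.

Lemma cellsD S S' : cells (S :\: S') = cells S `\` cells S'.
Proof.
apply/seteqP; split => x.
  move=> [w /=]; rewrite mem_enum inE => /andP[wS' wS] wx; split.
    by exists w => //=; rewrite mem_enum.
  move=> [v /=]; rewrite mem_enum => vS' vx.
  have vw : v = w by apply: (@trivIset_cell setT) => //; exists x.
  by rewrite -vw vS' in wS'.
move=> [[w /=]]; rewrite mem_enum => wS wx S'x; exists w => //=.
rewrite mem_enum inE wS andbT; apply/negP => wS'; apply: S'x.
by exists w => //=; rewrite mem_enum.
Qed.

Lemma lebesgue_cells S : (0 < #|W|)%N ->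
  @lebesgue_measure R (cells S) = (#|S|%:R / #|W|%:R)%:E.
Proof.
move=> W0; have N0 : (0 : R) < #|W|%:R by rewrite ltr0n.
rewrite /cells measure_fin_bigcup//; last 2 first.
- exact: trivIset_cell.
- by move=> w _; exact: measurable_itv.
rewrite -fsbig_seq ?enum_uniq//.
have lw w : lebesgue_measure (cell w) = (#|W|%:R^-1 : R)%:E.
  rewrite lebesgue_measure_itv/= lte_fin ltr_pM2r ?invr_gt0// ltr_nat ltnSn.
  by rewrite -EFinD -mulrBl -natrB// subSnn mul1r.
rewrite (eq_bigr (fun=> (#|W|%:R^-1 : R)%:E)); last by move=> w _; exact: lw.
by rewrite big_enum/= sumEFin sumr_const mulr_natl.
Qed.

(** Only the first side of the cube is subdivided; the others are all of [0, 1). Counting in [W]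
    thus becomes volume in any dimension [d >= 1]. *)
Lemma finite_uniform_partition d : (0 < d)%N -> (0 < #|W|)%N ->
  exists U : {set W} -> set (@Rd R d), [/\ forall S, measurable (U S),
    forall S S', U (S :\: S') = U S `\` U S' &
    forall S, @lebesgue_Rd R d (U S) = (#|S|%:R / #|W|%:R)%:E].
Proof.
case: d => // d _ W0.
pose side S (i : 'I_d.+1) := if i == ord0 then cells S else `[0, 1[%classic.
have mside S i : measurable (side S i : set (measurableTypeR R)).
  by rewrite /side; case: ifP => _; [exact: measurable_cells|exact: measurable_itv].
exists (fun S => [set t | forall i, side S i (tnth t i)]); split => [S|S S'|S].
- rewrite (_ : mkset _ =
      \bigcap_(i in [set: 'I_d.+1]) (@tnth _ R ^~ i) @^-1` side S i).
    apply: fin_bigcap_measurable => // i _.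
    rewrite -[X in measurable X]setTI.
    by apply: (@measurable_tnth _ (measurableTypeR R)) => //; exact: mside.
  by apply/seteqP; split => [t h i _|t h i]; exact: h.
- apply/seteqP; split => t /=.
    move=> h; split.
      move=> i; move: (h i); rewrite /side; case: ifP => // _.
      by rewrite cellsD => -[].
    by move=> /(_ ord0); move: (h ord0); rewrite /side/= cellsD => -[].
  (* The sides other than the first do not depend on [S], so a first coordinate in [cells S'] would
     put [t] in the whole box of [S']. *)
  move=> [h h'] i; move: (h i); rewrite /side; case: ifPn => [/eqP-> hi|//].
  rewrite cellsD; split => // h0; apply: h' => j.
  by move: (h j); rewrite /side; case: ifPn => [/eqP-> _|//].
- rewrite /lebesgue_Rd power_measure_box//.
  rewrite big_ord_recl/= [X in (X * _)%E]lebesgue_cells// big1 ?mule1// => i _.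
  rewrite /side /= lebesgue_measure_itv/= lte_fin ltr01.
  by rewrite -EFinD subr0.
Qed.

End cells.

Section rademacher.
Variable M : nat.

Definition flip (k : 'I_M) (w : {ffun 'I_M -> bool}) : {ffun 'I_M -> bool} :=
  [ffun i => (i == k) (+) w i].

Definition bit_set (k : 'I_M) : {set {ffun 'I_M -> bool}} :=
  [set w : {ffun 'I_M -> bool} | w k].

Lemma flipK k : involutive (flip k).
Proof. by move=> w; apply/ffunP => i; rewrite !ffunE addbA addbb. Qed.

(** [flip k] preserves [A] and exchanges its words with bit [k] set and unset, so the two halves
    have equal size. *)
Lemma card_bit_setD k (A : {set {ffun 'I_M -> bool}}) :
  (forall w, (flip k w \in A) = (w \in A)) -> (#|A :\: bit_set k|.*2 = #|A|)%N.
Proof.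
move=> kA; rewrite -(cardsID (bit_set k) A) -addnn; congr addn.
rewrite -(card_imset _ (can_inj (flipK k))); apply: eq_card => w.
rewrite !inE -[in LHS](flipK k w) mem_imset; last exact: can_inj (flipK k).
by rewrite !inE kA ffunE eqxx addTb negbK andbC.
Qed.

Lemma card_bit_setC k : (#|finset.setTfor _ :\: bit_set k|.*2 = #|{ffun 'I_M -> bool}|)%N.
Proof. by rewrite card_bit_setD ?finset.cardsT// => w; rewrite !inE. Qed.

Lemma card_bit_set k : (#|bit_set k|.*2 = #|{ffun 'I_M -> bool}|)%N.
Proof.
have := cardsID (bit_set k) (finset.setTfor _); rewrite finset.setTI finset.cardsT.
by rewrite -(card_bit_setC k) -!addnn => /addIn ->.
Qed.

(** Independence of two bits: [bit_set j] is stable under flipping another bit [k], so removing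
    [bit_set k] halves it again. *)
Lemma card_bit_setDD j k : j != k ->
  (#|bit_set j :\: bit_set k|.*2.*2 = #|{ffun 'I_M -> bool}|)%N.
Proof.
move=> jk; rewrite card_bit_setD ?card_bit_set// => w.
by rewrite !inE ffunE (negbTE jk).
Qed.

Lemma rademacher_sets (R : realType) d : (0 < d)%N ->
  exists (Q : set (@Rd R d)) (B : 'I_M -> set (@Rd R d)),
  [/\ measurable Q, forall j, measurable (B j) /\ B j `<=` Q,
      @lebesgue_Rd R d Q = 1%E,
      forall j, @lebesgue_Rd R d (B j) = (2^-1)%:E /\
                @lebesgue_Rd R d (Q `\` B j) = (2^-1)%:E &
      forall j k, j != k -> @lebesgue_Rd R d (B j `\` B k) = (4^-1)%:E].
Proof.
move=> d0; have W0 : (0 < #|{ffun 'I_M -> bool}|)%N.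
  by apply/card_gt0P; exists [ffun=> true].
have WR0 : #|{ffun 'I_M -> bool}|%:R != 0 :> R by rewrite pnatr_eq0 -lt0n.
have ratio m k : (m * k)%N = #|{ffun 'I_M -> bool}| ->
    (m%:R / #|{ffun 'I_M -> bool}|%:R)%:E = (k%:R^-1 : R)%:E.
  move=> mk.
  rewrite -mk natrM mulf_eq0 negb_or in WR0; case/andP: WR0 => m0 k0.
  by rewrite -mk natrM invfM mulrA mulfV// mul1r.
have [U [mU UD lU]] := @finite_uniform_partition R _ d d0 W0.
exists (U (finset.setTfor _)), (fun j => U (bit_set j)); split => //.
(* [bit_set j] is written as a difference from the full set, since [U] is only known to commute with
   differences. *)
- by move=> j; split => //; rewrite -[bit_set j]finset.setCK -finset.setTD UD; exact: subDsetl.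
- by rewrite lU finset.cardsT divff.
- move=> j; split; [rewrite lU|rewrite -UD lU]; apply: ratio; rewrite muln2.
    exact: card_bit_set.
  exact: card_bit_setC.
- move=> j k jk; rewrite -UD lU; apply: ratio.
  by rewrite -(card_bit_setDD _ _ jk) -!muln2 -mulnA.
Qed.

End rademacher.

(** * Hellinger distance and two-level densities *)

Section L2.
Context d {T : measurableType d} {R : realType} (mu : {measure set T -> \bar R}).

Lemma Lnorm2E (f : T -> R) :
  ('N[mu]_2%:E[EFin \o f] = (\int[mu]_x (f x ^+ 2)%:E) `^ 2^-1)%E.
Proof.
rewrite unlock; congr (_ `^ _)%E; apply: eq_integral => x _ /=.
by rewrite powR_mulrn// real_normK// num_real.
Qed.

Lemma Lnorm2_sqrt (f : T -> R) s : (\int[mu]_x (f x ^+ 2)%:E = s%:E)%E ->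
  'N[mu]_2%:E[EFin \o f]%E = (Num.sqrt s)%:E.
Proof.
move=> fs; have s0 : 0 <= s.
  by rewrite -lee_fin -fs; apply: integral_ge0 => x _; rewrite lee_fin sqr_ge0.
by rewrite Lnorm2E fs poweR_EFin powR12_sqrt.
Qed.

(** Hölder's inequality with both exponents 2; the sign condition identifies the L1 norm of the
    product with its integral. *)
Lemma integral_cauchy_schwarz (f g : T -> R) s t :
  measurable_fun setT f -> measurable_fun setT g ->
  (forall x, 0 <= f x * g x) ->
  (\int[mu]_x (f x ^+ 2)%:E = s%:E -> \int[mu]_x (g x ^+ 2)%:E = t%:E ->
   \int[mu]_x (f x * g x)%:E <= (Num.sqrt s * Num.sqrt t)%:E)%E.
Proof.
move=> mf mg fg0 fs gt.
have h : (2^-1 + 2^-1 = 1 :> R) by lra.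
have := @hoelder _ _ _ mu f g 2 2 mf mg (ltr0n _ 2) (ltr0n _ 2) h.
rewrite Lnorm1 (Lnorm2_sqrt _ _ fs) (Lnorm2_sqrt _ _ gt) -EFinM.
by under eq_integral do rewrite /= ger0_norm//.
Qed.

End L2.

Section hellinger.
Context {R : realType} (d : nat).
Implicit Types f g h : @Rd R d -> R.

Lemma hellinger_sym f g : hellinger f g = hellinger g f.
Proof.
rewrite /hellinger -[RHS]oppe_Lnorm; apply: eq_Lnorm => x /=.
by rewrite opprB.
Qed.

Lemma hellinger_refl f : hellinger f f = 0%E.
Proof.
rewrite /hellinger (_ : (fun x => _) = cst 0%E) ?Lnorm0//.
by apply/funext => x; rewrite subrr.
Qed.

Lemma hellinger_triangle f g h : measurable_fun setT f ->
  measurable_fun setT g -> measurable_fun setT h ->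
  (hellinger f h <= hellinger f g + hellinger g h)%E.
Proof.
move=> mf mg mh.
have ms (u : @Rd R d -> R) : measurable_fun setT u -> measurable_fun setT (fun x => Num.sqrt (u x)).
  exact: measurable_funT_sqrt.
rewrite /hellinger.
rewrite (_ : (fun x => _%:E) = EFin \o
    ((fun x => Num.sqrt (f x) - Num.sqrt (g x)) \+ (fun x => Num.sqrt (g x) - Num.sqrt (h x)))); last first.
  by apply/funext => x /=; congr EFin; ring.
by apply: minkowski_EFin; rewrite ?ler1n//; apply: measurable_funB; exact: ms.
Qed.

(** The squared distance integrates over [x] a jointly measurable non-negative function of (X, x),
    so Tonelli applies. This makes the testing events and the risk integrand measurable. *)
Lemma measurable_hellinger n (fhat : n.-tuple (@Rd R d) -> @Rd R d -> R) f :
  estimator fhat -> measurable_fun setT f ->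
  measurable_fun setT (fun X => hellinger (fhat X) f).
Proof.
move=> [mfhat _] mf.
rewrite (_ : (fun X => _) = fun X =>
    ((fubini_F (@lebesgue_Rd R d) (fun p => ((Num.sqrt (fhat p.1 p.2) -
       Num.sqrt (f p.2)) ^+ 2)%:E) X) `^ 2^-1)%E); last first.
  by apply/funext => X; rewrite /hellinger -[RHS]Lnorm2E.
apply: (measurableT_comp (measurable_poweR _)) => //.
apply: measurable_fun_fubini_tonelli_F; last by move=> p; rewrite lee_fin sqr_ge0.
apply/measurable_EFinP/measurable_funX/measurable_funB.
  exact: measurable_funT_sqrt.
by apply: measurable_funT_sqrt; exact: (measurableT_comp mf).
Qed.

End hellinger.

Section two_level.
Context {R : realType} (d : nat) (Q B : set (@Rd R d)).
Hypotheses (mQ : measurable Q) (mB : measurable B) (BQ : B `<=` Q).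
Hypotheses (lB : @lebesgue_Rd R d B = (2^-1)%:E)
  (lQB : @lebesgue_Rd R d (Q `\` B) = (2^-1)%:E).

Definition two_level (a b : R) (x : @Rd R d) : R :=
  a * \1_B x + b * \1_(Q `\` B) x.

Lemma two_levelB a b x : B x -> two_level a b x = a.
Proof.
move=> Bx; rewrite /two_level !indicE mem_set// memNset ?mulr1 ?mulr0 ?addr0//.
by move=> -[].
Qed.

Lemma two_levelD a b x : Q x -> ~ B x -> two_level a b x = b.
Proof.
move=> Qx Bx; rewrite /two_level !indicE memNset// mem_set ?mulr1 ?mulr0 ?add0r//.
Qed.

Lemma two_levelN a b x : ~ Q x -> two_level a b x = 0.
Proof.
move=> Qx; rewrite /two_level !indicE !memNset ?mulr0 ?addr0//; first by case.
by move=> /BQ.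
Qed.

Lemma two_level_sqr a b x : two_level a b x ^+ 2 = two_level (a ^+ 2) (b ^+ 2) x.
Proof.
have [Bx|Bx] := pselect (B x); first by rewrite !two_levelB.
have [Qx|Qx] := pselect (Q x); first by rewrite !two_levelD.
by rewrite !two_levelN// expr0n.
Qed.

Lemma measurable_two_level a b : measurable_fun setT (two_level a b).
Proof.
apply: measurable_funD; apply: measurable_funM => //; apply: measurable_indic => //.
exact: measurableD.
Qed.

Lemma two_level_bounds a b A x : 0 <= a <= A -> 0 <= b <= A ->
  0 <= two_level a b x <= A.
Proof.
move=> aA bA.
have [Bx|Bx] := pselect (B x); first by rewrite !two_levelB.
have [Qx|Qx] := pselect (Q x); first by rewrite !two_levelD.
by rewrite !two_levelN// lexx/=; case/andP: aA => /le_trans; apply.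
Qed.

Lemma integral_two_level a b : 0 <= a -> 0 <= b ->
  (\int[@lebesgue_Rd R d]_x (two_level a b x)%:E = ((a + b) / 2)%:E)%E.
Proof.
move=> a0 b0; have mQB : measurable (Q `\` B) by exact: measurableD.
under eq_integral do rewrite EFinD 2!EFinM.
rewrite ge0_integralD//=; last 4 first.
- by move=> x _; rewrite -EFinM lee_fin mulr_ge0.
- by apply: measurable_funeM; apply/measurable_EFinP; exact: measurable_indic.
- by move=> x _; rewrite -EFinM lee_fin mulr_ge0.
- by apply: measurable_funeM; apply/measurable_EFinP; exact: measurable_indic.
rewrite !ge0_integralZl//; last 2 first.
- by apply/measurable_EFinP; exact: measurable_indic.
- by apply/measurable_EFinP; exact: measurable_indic.
by rewrite !integral_indic// !setIT [X in (_ * X + _)%E]lB [X in (_ + _ * X)%E]lQB -!EFinM -EFinD mulrDl.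
Qed.

(** Cauchy-Schwarz for Lebesgue measure separates [h] restricted to [Q] from the density, whose
    square integrates to ((1 + gamma)^2 + (1 - gamma)^2) / 2 = 1 + gamma^2. *)
Lemma two_level_cauchy_schwarz (gamma : R) (P P0 : probability (@Rd R d) R)
    (h : @Rd R d -> R) (s : R) :
  0 <= gamma <= 1 ->
  density_law (two_level (1 + gamma) (1 - gamma)) = P ->
  density_law (\1_Q : @Rd R d -> R) = P0 ->
  measurable_fun setT h -> (forall x, 0 <= h x) ->
  (\int[P0]_x (h x ^+ 2)%:E = s%:E ->
   \int[P]_x (h x)%:E <= (Num.sqrt (1 + gamma ^+ 2) * Num.sqrt s)%:E)%E.
Proof.
move=> /andP[g0 g1] eP eP0 mh h0.
have two_level11 : (\1_Q : @Rd R d -> R) = two_level 1 1.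
  apply/funext => x; rewrite indicE; have [Bx|Bx] := pselect (B x).
    by rewrite two_levelB// mem_set//; exact: BQ.
  have [Qx|Qx] := pselect (Q x); first by rewrite two_levelD// mem_set.
  by rewrite two_levelN// memNset.
rewrite two_level11 in eP0.
have u0 a b x : 0 <= a -> 0 <= b -> 0 <= two_level a b x.
  move=> a0 b0; have aA : 0 <= a <= Num.max a b by rewrite a0 le_max lexx.
  have bA : 0 <= b <= Num.max a b by rewrite b0 le_max lexx orbT.
  by case/andP: (two_level_bounds _ _ _ x aA bA).
have gm : 0 <= 1 - gamma by rewrite subr_ge0.
have gp : 0 <= 1 + gamma by rewrite addr_ge0.
have mt := measurable_two_level.
rewrite (@integral_density_probability _ _ _ (@lebesgue_Rd R d) (two_level 1 1)
  (mt _ _) P0 _ eP0); [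
  |by apply/measurable_EFinP; exact: measurable_funX
  |by move=> x; rewrite lee_fin sqr_ge0].
rewrite (@integral_density_probability _ _ _ (@lebesgue_Rd R d) _
  (mt _ _) P _ eP); [
  |exact/measurable_EFinP
  |by move=> x; rewrite lee_fin].
move=> hs; rewrite mulrC.
(* The density vanishes outside [Q], so [two_level 1 1], the indicator of [Q], can be inserted; the
   square of the first factor then integrates to [s]. *)
rewrite (_ : (\int[_]_x _ = \int[@lebesgue_Rd R d]_x
    (h x * two_level 1 1 x * two_level (1 + gamma) (1 - gamma) x)%:E)%E); last first.
  apply: eq_integral => x _; rewrite -EFinM; congr EFin; rewrite -mulrA; congr (_ * _).
  have [Bx|Bx] := pselect (B x); first by rewrite !two_levelB// mul1r.
  have [Qx|Qx] := pselect (Q x); first by rewrite !two_levelD// mul1r.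
  by rewrite !two_levelN// mul0r.
apply: integral_cauchy_schwarz.
- by apply: measurable_funM => //; exact: measurable_two_level.
- exact: measurable_two_level.
- by move=> x; rewrite !mulr_ge0// u0.
- rewrite -hs; apply: eq_integral => x _.
  by rewrite exprMn two_level_sqr expr1n EFinM.
- under eq_integral do rewrite two_level_sqr.
  by rewrite integral_two_level ?sqr_ge0//; congr EFin; field.
Qed.

End two_level.

(** The set [B \ B'], of volume 1/4, suffices: there the densities are 1 + gamma and 1 - gamma,
    whose roots differ by at least [gamma], so the squared distance is at least gamma^2 / 4. *)
Lemma hellinger_two_level {R : realType} (d : nat) (Q B B' : set (@Rd R d)) (gamma : R) :
  measurable Q -> measurable B -> measurable B' -> B `<=` Q -> B' `<=` Q ->
  @lebesgue_Rd R d (B `\` B') = (4^-1)%:E -> 0 <= gamma <= 1 ->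
  ((gamma / 2)%:E <= hellinger (two_level _ Q B (1 + gamma) (1 - gamma))
                     (two_level _ Q B' (1 + gamma) (1 - gamma)))%E.
Proof.
move=> mQ mB mB' BQ BQ' lBB' /andP[g0 g1].
rewrite /hellinger [leRHS]Lnorm2E.
(* Writing the bound as a square root reduces the claim to a comparison of integrals. *)
rewrite (_ : (gamma / 2)%:E = (((gamma ^+ 2 / 4)%:E) `^ 2^-1)%E); last first.
  rewrite poweR_EFin powR12_sqrt; last by rewrite divr_ge0// sqr_ge0.
  rewrite (_ : gamma ^+ 2 / 4 = (gamma / 2) ^+ 2); last by field.
  by rewrite sqrtr_sqr ger0_norm// divr_ge0.
have mBB' : measurable (B `\` B') by exact: measurableD.
have ms (u : @Rd R d -> R) : measurable_fun setT u -> measurable_fun setT (fun x : @Rd R d => Num.sqrt (u x)).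
  exact: measurable_funT_sqrt.
apply: gt0_ler_poweR; rewrite ?in_itv/= ?lee_fin ?leey ?andbT ?divr_ge0 ?sqr_ge0//.
  by apply: integral_ge0 => x _; rewrite lee_fin sqr_ge0.
apply: (@le_trans _ _ (\int[@lebesgue_Rd R d]_(x in B `\` B') (gamma ^+ 2)%:E)%E).
  by rewrite integral_cst// [X in (_ <= _ * X)%E]lBB' -EFinM.
apply: (@le_trans _ _ (\int[@lebesgue_Rd R d]_(x in B `\` B')
  ((Num.sqrt (two_level _ Q B (1 + gamma) (1 - gamma) x) -
    Num.sqrt (two_level _ Q B' (1 + gamma) (1 - gamma) x)) ^+ 2)%:E)%E); last first.
  apply: ge0_subset_integral => //.
  - apply/measurable_EFinP/measurable_funX/measurable_funB.
      by apply: ms; exact: measurable_two_level.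
    by apply: ms; exact: measurable_two_level.
  - by move=> x _; rewrite lee_fin sqr_ge0.
apply: ge0_le_integral => //.
- by move=> x _; rewrite lee_fin sqr_ge0.
- apply/measurable_funTS/measurable_EFinP/measurable_funX/measurable_funB.
    by apply: ms; exact: measurable_two_level.
  by apply: ms; exact: measurable_two_level.
move=> x [Bx B'x]; rewrite lee_fin two_levelB// two_levelD//; last exact: BQ.
have a0 : 0 <= 1 + gamma by lra.
have b0 : 0 <= 1 - gamma by lra.
have := sqr_sqrtr a0; have := sqr_sqrtr b0.
have := sqrtr_ge0 (1 + gamma); have := sqrtr_ge0 (1 - gamma).
move: (Num.sqrt (1 + gamma)) (Num.sqrt (1 - gamma)) => u v v0 u0 v2 u2.
(* (u - v) (u + v) = 2 gamma and (u + v)^2 <= 2 (u^2 + v^2) = 4 *)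
have s4 : (u + v) ^+ 2 <= 4 by have := sqr_ge0 (u - v); nra.
have : (u - v) ^+ 2 * (u + v) ^+ 2 = 4 * gamma ^+ 2.
  by rewrite -exprMn -subr_sqr u2 v2; ring.
have := sqr_ge0 (u - v); nra.
Qed.

(** * Reduction to testing *)

Lemma pigeonhole_measure d (T : measurableType d) (R : realType)
    (mu : {measure set T -> \bar R}) M (A : 'I_M -> set T) :
  (0 < M)%N -> (forall j, measurable (A j)) -> trivIset setT A ->
  (mu setT <= 1)%E -> exists j, (mu (A j) <= (M%:R^-1)%:E)%E.
Proof.
move=> M0 mA tA muT; apply: contrapT => /forallNP h.
have h' j : ((M%:R^-1)%:E < mu (A j))%E by rewrite ltNge; exact/negP/h.
have : (\sum_(j < M) mu (A j) <= 1)%E.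
  rewrite -measure_bigsetU_ord//; apply: le_trans muT; apply: le_measure => //.
  - by rewrite inE; apply: bigsetU_measurable.
  - by rewrite inE.
suff : (1 < \sum_(j < M) mu (A j))%E by rewrite ltNge => /negbTE ->.
case: M M0 A mA tA h h' => // M _ A mA tA _ h'.
(* One summand is split off to supply strictness; the other [M] only need the weak bound. *)
rewrite big_ord_recl (_ : 1%E = ((M.+1%:R^-1 : R)%:E + (M%:R * M.+1%:R^-1 : R)%:E)%E).
  apply: lte_leD => //.
  have -> : (M%:R * M.+1%:R^-1 : R)%:E = (\sum_(i < M) (M.+1%:R^-1 : R)%:E)%E.
    by rewrite sumEFin sumr_const card_ord mulr_natl.
  by apply: lee_sum => i _; exact/ltW.
by rewrite -EFinD -{1}[M.+1%:R^-1]mul1r -mulrDl nat1r divff// pnatr_eq0.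
Qed.

Lemma power_measure_setC (R : realType) d (T : measurableType d)
    (P : probability T R) n (A : set (n.-tuple T)) : measurable A ->
  power_measure P n (~` A) = (1 - power_measure P n A)%E.
Proof.
move=> mA; rewrite -(power_measure_setT P n) -(setUv A) measureU//; last 2 first.
- exact: measurableC.
- exact: setICr.
by rewrite [X in (X - _)%E]addeC addeK// power_measure_fin_num.
Qed.

(** The index [j] comes from the pigeonhole principle under [P0] and may depend on [fhat]; this is
    enough because the supremum over densities is taken after the estimator is fixed. *)
Lemma hellinger_risk_ge (R : realType) d M n (q s r : R)
    (fs : 'I_M -> @Rd R d -> R) (P0 : probability (@Rd R d) R)
    (P : 'I_M -> probability (@Rd R d) R) fhat :
  (0 < M)%N -> 0 < s -> 0 < q -> 0 <= r -> estimator fhat ->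
  (forall j, measurable_fun setT (fs j)) ->
  (forall j, density_law (fs j) = P j) ->
  (forall j k, j != k -> ((s *+ 2)%:E <= hellinger (fs j) (fs k))%E) ->
  (forall j A, measurable A ->
    (power_measure (P j) n A <= (r * Num.sqrt (fine (power_measure P0 n A)))%:E)%E) ->
  exists j, ((s `^ q * (1 - r * Num.sqrt (M%:R^-1)))%:E <=
    hellinger_risk q (fhat : n.-tuple (@Rd R d) -> _) (fs j))%E.
Proof.
move=> M0 s0 q0 r0 est mf lawP sep PP0.
have mH j := measurable_hellinger _ _ _ (fs j) est (mf j).
pose A j := [set X | (hellinger (fhat X) (fs j) < s%:E)%E].
have mA j : measurable (A j).
  by rewrite -[A j]setTI; apply: emeasurable_fun_infty_o.
have tA : trivIset setT A.
  (* A common sample would put two hypotheses within [s] of the same estimate, against their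
     separation 2 s. *)
  move=> j k _ _ [X [/= Aj Ak]]; apply/eqP; apply: contrapT => /negP jk.
  have mX : measurable_fun setT (fhat X).
    exact: (measurableT_comp est.1 (pair1_measurable X)).
  have := hellinger_triangle _ _ _ _ (mf j) mX (mf k).
  rewrite [X in (_ <= X + _)%E]hellinger_sym => h1.
  have := le_lt_trans (le_trans (sep _ _ jk) h1) (lteD Aj Ak).
  by rewrite -EFinD mulr2n ltxx.
have [j Aj] := pigeonhole_measure _ _ _ (power_measure P0 n) _ A M0 mA tA
  (power_measure_le1 _ _ _ measurableT).
exists j; rewrite /hellinger_risk /expectation_iid lawP.
have mAC : measurable (~` A j) by exact: measurableC.
(* Markov's inequality: on the complement of [A j] the distance is at least [s], and elsewhere the
   integrand is non-negative. *)
apply: (@le_trans _ _ (\int[power_measure (P j) n]_(X in ~` A j) (s `^ q)%:E)%E).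
  rewrite integral_cst// [X in (_ * X)%E]power_measure_setC// EFinM; apply: lee_wpmul2l.
    by rewrite lee_fin powR_ge0.
  rewrite EFinB leeB//; apply: le_trans (PP0 _ _ (mA j)) _.
  rewrite lee_fin ler_wpM2l// ler_sqrt ?invr_ge0//.
  by rewrite -lee_fin fineK// power_measure_fin_num.
have mHq : measurable_fun setT (fun X => (hellinger (fhat X) (fs j) `^ q)%E).
  exact: (measurableT_comp (measurable_poweR _)).
apply: (@le_trans _ _ (\int[power_measure (P j) n]_(X in ~` A j)
    (hellinger (fhat X) (fs j) `^ q))%E).
  apply: ge0_le_integral => //.
  - by move=> X _; rewrite lee_fin powR_ge0.
  - exact: measurable_funTS.
  - move=> X /= /negP; rewrite -leNgt => sX; rewrite -poweR_EFin.
    apply: gt0_ler_poweR => //; first exact: ltW.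
      by rewrite in_itv/= leey lee_fin ltW.
    by rewrite in_itv/= leey andbT Lnorm_ge0.
apply: ge0_subset_integral => // X _; exact: poweR_ge0.
Qed.

(** As [fs j] is itself an oracle function, its oracle risk is 0^q = 0, by [0 < q]. It is therefore
    admissible in the supremum, with regret equal to its risk. *)
Lemma worst_regret_ge (R : realType) d M n (A q : R)
    (fs : 'I_M -> @Rd R d -> R) (fhat : n.-tuple (@Rd R d) -> @Rd R d -> R) j :
  0 < q -> bounded_density A (fs j) ->
  (hellinger_risk q fhat (fs j) <= worst_regret A q fs fhat)%E.
Proof.
move=> q0 fj.
have or0 : oracle_risk q fs (fs j) = 0%E.
  apply/eqP; rewrite eq_le; apply/andP; split.
    apply: (@bigmin_inf _ _ _ _ j) => //.
    by rewrite hellinger_refl poweR0r// gt_eqF.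
  by apply: le_bigmin => [|k _]; [exact: leey|exact: poweR_ge0].
apply: ereal_sup_ubound; exists (fs j); first by split; rewrite /= ?or0.
by rewrite or0 sube0.
Qed.

(** * Choice of the constants and the lower bound *)

Lemma chi_square_factor_le (R : realType) (M n : nat) (gamma : R) : (2 <= M)%N ->
  gamma ^+ 2 * n%:R = ln M%:R / 16 ->
  Num.sqrt (1 + gamma ^+ 2) ^+ n * Num.sqrt M%:R^-1 <= expR (- (15 / 32 * ln 2)).
Proof.
move=> M2 gM; have M0 : (0 : R) < M%:R by rewrite ltr0n (leq_trans _ M2).
have p1 : 0 <= 1 + gamma ^+ 2 by rewrite addr_ge0// sqr_ge0.
have lM : ln 2 <= ln M%:R :> R by rewrite ler_ln ?posrE// ler_nat.
(* After squaring: (1 + gamma^2)^n / M <= exp(ln M / 16) / M = M^(-15/16) <= 2^(-15/16). *)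
rewrite -(@ler_pXn2r _ 2)// ?nnegrE ?mulr_ge0 ?exprn_ge0 ?sqrtr_ge0 ?expR_ge0//.
rewrite exprMn exprAC !sqr_sqrtr// ?invr_ge0 ?(ltW M0)//.
apply: (@le_trans _ _ (expR (ln M%:R / 16) * expR (- ln M%:R))).
  rewrite expRN lnK ?posrE// ler_wpM2r ?invr_ge0 ?(ltW M0)//.
  by rewrite -gM expRM_natr lerXn2r ?nnegrE ?expR_ge0//; exact: expR_ge1Dx.
by rewrite -expRD -expRM_natr ler_expR; lra.
Qed.

Theorem theorem2 (R : realType) (A q : R) (hA : 1 < A) (hq : 0 < q) :
  exists2 c : R, 0 < c &
    forall d M n : nat, (1 <= d)%N -> (2 <= M)%N -> (1 <= n)%N ->
      ln (M%:R : R) <= 16 * Num.min 1 (A - 1) ^+ 2 * n%:R ->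
      ((c * powR (ln M%:R / n%:R) (q / 2))%:E <=
        ereal_sup [set
          ereal_inf [set worst_regret A q fs fhat | fhat in @estimator R d n]
          | fs in [set fs : 'I_M -> Rd d -> R |
                    forall j, bounded_nonneg A (fs j)]])%E.
Proof.
(* [rho] is 2^(-15/32), the value at M = 2 of the bound M^(-15/32) on P_j(A_j). *)
pose rho : R := expR (- (15 / 32 * ln 2)).
have ln2 : 0 < ln 2 :> R by rewrite ln_gt0// ltr1n.
have rho1 : rho < 1 by rewrite /rho expR_lt1; lra.
(* Here 16 = 4 * 4: [gamma] is a quarter of the root of ln M / n, and the testing radius [s] is a
   quarter of [gamma]. *)
exists (16^-1 `^ q * (1 - rho)).
  by rewrite mulr_gt0 ?powR_gt0 ?subr_gt0 ?invr_gt0.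
move=> d M n d0 M2 n0 hM.
have nR : (0 : R) < n%:R by rewrite ltr0n.
have lM : 0 < ln M%:R :> R by rewrite ln_gt0// ltr1n.
pose L : R := ln M%:R / n%:R; have L0 : 0 < L by rewrite divr_gt0.
pose gamma : R := Num.sqrt L / 4.
have g0 : 0 < gamma by rewrite divr_gt0// sqrtr_gt0.
have g2 : gamma ^+ 2 = L / 16.
  by rewrite /gamma expr_div_n sqr_sqrtr ?ltW//; congr (_ / _); ring.
(* This is the assumption on ln M after taking roots. The bound by 1 keeps the level 1 - gamma
   non-negative, and the bound by A - 1 keeps 1 + gamma at most [A]. *)
have gm : gamma <= Num.min 1 (A - 1).
  have m0 : 0 <= Num.min 1 (A - 1) by rewrite le_min ler01/= subr_ge0 ltW.
  rewrite -(@ler_pXn2r _ 2)// ?nnegrE ?(ltW g0)// g2 ler_pdivrMr//.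
  by rewrite /L ler_pdivrMr//; apply: le_trans hM _; rewrite (mulrC 16).
move: gm; rewrite le_min => /andP[g1 gA].
have g01 : 0 <= gamma <= 1 by rewrite ltW.
have [Q [B [mQ mBQ lQ lB lBB]]] := rademacher_sets M R d d0.
pose fs j := two_level d Q (B j) (1 + gamma) (1 - gamma).
have fsA j : bounded_density A (fs j).
  have [mB BQ] := mBQ j; have [lBj lQB] := lB j; split; last first.
    by rewrite integral_two_level//; [congr EFin; lra|lra|lra].
  split; first exact: measurable_two_level.
  by move=> x; apply: two_level_bounds => //; apply/andP; split; lra.
have mfs j : measurable_fun setT (fs j) by case: (fsA j) => -[].
have /(_ _)/cid-/all_sig[P PE] j : exists P : probability (@Rd R d) R, density_law (fs j) = P.
  have [[_ f0] f1] := fsA j; apply: density_probability_ex => //.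
  by move=> x; case/andP: (f0 x).
have M0 : (0 < M)%N by exact: leq_trans M2.
pose j0 : 'I_M := Ordinal M0.
have [P0 P0E] : exists P : probability (@Rd R d) R,
    density_law (\1_Q : @Rd R d -> R) = P.
  apply: density_probability_ex; first exact: measurable_indic.
    by move=> x; rewrite indicE.
  by rewrite integral_indic// setIT.
apply: (@le_trans _ _ (ereal_inf [set worst_regret A q fs fhat | fhat in @estimator R d n])).
  apply: le_ereal_inf_tmp => _ [fhat est <-].
  pose s := gamma / 4; have s0 : 0 < s by rewrite divr_gt0.
  pose r := Num.sqrt (1 + gamma ^+ 2) ^+ n.
  have r0 : 0 <= r by rewrite exprn_ge0// sqrtr_ge0.
  have sep j k : j != k -> ((s *+ 2)%:E <= hellinger (fs j) (fs k))%E.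
    move=> jk; rewrite (_ : s *+ 2 = gamma / 2); last by rewrite /s; lra.
    by have [[? ?] [? ?]] := (mBQ j, mBQ k); apply: hellinger_two_level => //; exact: lBB.
  have PP0 j X : measurable X ->
      (power_measure (P j) n X <= (r * Num.sqrt (fine (power_measure P0 n X)))%:E)%E.
    apply: power_measure_cauchy_schwarz => [|h t mh h0]; first exact: sqrtr_ge0.
    have [[mB BQ] [lBj lQB]] := (mBQ j, lB j).
    exact: (two_level_cauchy_schwarz _ _ _ mQ mB BQ lBj lQB _ _ _ _ _ g01 (PE j) P0E).
  have [j hj] := @hellinger_risk_ge R d M n q s r fs P0 P fhat M0 s0 hq r0 est mfs PE sep PP0.
  apply: le_trans (worst_regret_ge _ _ _ _ _ _ _ _ j hq (fsA j)).
  apply: le_trans hj.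
  (* Since L^(q/2) is the q-th power of the root of [L], the left side becomes s^q (1 - rho). *)
  rewrite -/L (mulrC q) powRrM powR12_sqrt ?(ltW L0)// lee_fin mulrAC -powRM ?sqrtr_ge0 ?invr_ge0//.
  rewrite (_ : 16^-1 * Num.sqrt L = s); last by rewrite /s /gamma; field.
  rewrite ler_wpM2l ?powR_ge0// lerB//; apply: chi_square_factor_le => //.
  by rewrite g2 /L; field; rewrite gt_eqF.
by apply: ereal_sup_ubound; exists fs => // j; case: (fsA j).
Qed.
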